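(* Let $n\geq 4$. Let $\tilde C$ be a conjugacy class in $A_n$ and let $\lambda=\lambda_1^{e_1}\cdots\lambda_r^{e_r}$ be the partition of $n$ giving the cycle type of its elements. (1) The conjugacy class $\tilde C$ is rational in $A_n$ if and only if one of the following holds: (a) $e_i\geq 2$ for some $i$ or some $\lambda_i$ is even; or (b) $e_i=1$ for all $i$, all $\lambda_i$ are odd, and the product $\prod_{i=1}^r\lambda_i$ is a perfect square. When all parts are distinct and odd, $\lambda$ corresponds to two conjugacy classes in $A_n$, and these are either both rational or both non-rational. (2) Every conjugacy class of $A_n$ which is rational is a rational class of $A_n$. If $\tilde C$ is not a rational conjugacy class in $A_n$, then the conjugacy class $C$ of $S_n$ containing $\tilde C$ is a rational class in $A_n$.
   Context: A partition of $n$ is written $\lambda_1^{e_1}\cdots\lambda_r^{e_r}$ with $1\le\lambda_1<\cdots<\lambda_r\le n$, $e_i>0$, $\sum_i e_i\lambda_i=n$ (the part $\lambda_i$ occurs $e_i$ times, fixed points counting as parts equal to $1$). Let $G$ be a finite group and let $o(g)$ denote the order of $g\in G$. An element $g\in G$ is rational in $G$ if $g$ is conjugate in $G$ to $g^m$ for every integer $m$ with $(m,o(g))=1$; a conjugacy class of $G$ is rational if it is the conjugacy class of a rational element. The rational class of $g\in G$ is the subset of $G$ consisting of all elements conjugate in $G$ to $g^m$ for some $m$ with $(m,o(g))=1$; a subset is a rational class in $G$ if it is the rational class of some element. *)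

(* Defs.v *)
From HB Require Import structures.
From mathcomp Require Import all_boot all_order all_algebra all_fingroup.
From mathcomp Require Import all_solvable.

Set Implicit Arguments.
Unset Strict Implicit.
Unset Printing Implicit Defensive.

Definition expgz (gT : finGroupType) (g : gT) (m : int) : gT :=
  match m with
  | Posz k => (g ^+ k)%g
  | Negz k => (g ^- k.+1)%g
  end.

Definition rational_elt (gT : finGroupType) (G : {group gT}) (g : gT) : Prop :=
  g \in G /\
  forall m : int, coprimez m (Posz #[g]%g) -> expgz g m \in (g ^: G)%g.

Definition rational_conj_class (gT : finGroupType) (G : {group gT})
    (K : {set gT}) : Prop :=
  exists2 g : gT, rational_elt G g & K = (g ^: G)%g.

(* A rational class is a union of conjugacy classes, one for each generator
   of <[g]> up to conjugacy; it need not be a single conjugacy class. *)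
Definition is_rational_class (gT : finGroupType) (G : {group gT})
    (X : {set gT}) : Prop :=
  exists2 g : gT, g \in G &
    forall x : gT, x \in X <->
      exists2 m : int, coprimez m (Posz #[g]%g) & x \in (expgz g m ^: G)%g.

(* The partition lam_1^{e_1} ... lam_r^{e_r} of n, in multiplicity notation. *)
Definition is_partition (n r : nat) (lam e : 'I_r -> nat) : Prop :=
  [/\ forall i, 1 <= lam i <= n,
      forall i j : 'I_r, i < j -> lam i < lam j,
      forall i, 0 < e i
    & \sum_(i < r) e i * lam i = n].

(* When lam is injective the sum on the right is e i if d = lam i, and 0 if d
   is not a part. Fixed points are singleton orbits in porbits s. *)
Definition has_cycle_type (n r : nat) (s : {perm 'I_n}) (lam e : 'I_r -> nat)
    : Prop :=
  forall d : nat,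
    #|[set c in porbits s | #|c| == d]| = \sum_(i < r | lam i == d) e i.

Definition class_has_cycle_type (n r : nat) (K : {set {perm 'I_n}})
    (lam e : 'I_r -> nat) : Prop :=
  forall s, s \in K -> has_cycle_type s lam e.

(* Main.v *)
Require Import Defs.
From mathcomp Require Import all_boot all_order all_algebra all_fingroup.
From mathcomp Require Import all_solvable.
From mathcomp Require Import finfield zify.

(** Let [s] be an even permutation. For [m] prime to the order of [s] the
    permutations [s] and [s ^+ m] have the same orbits, hence are conjugate in
    the symmetric group, and the question is whether the conjugating
    permutation can be taken even.

    If [s] commutes with an odd permutation, it always can, and the class of
    [s] under the alternating group is its class under the symmetric group.
    This happens as soon as a cycle length is even (the cycle itself is odd) or
    an odd length occurs twice (exchanging the two cycles is odd):
    [odd_centralizer_cycle_type].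

    Suppose now that the cycle lengths are odd and distinct. A permutation [t]
    with [s ^ t = s ^+ m] must map each orbit to itself, the orbit sizes being
    distinct. Identify an orbit of length [k] with the integers mod [k] so that
    [s] is the shift by one: then [t] becomes an affine map of slope [m]. Shifts
    of an odd cycle are even, so the sign of [t] is the product over the cycle
    lengths [k] of the signs of the multiplications by [m] mod [k]
    ([odd_conj_expg]). As in Zolotarev's lemma, this sign is the Jacobi symbol
    of [m] over [k], but all that is needed of it is that it is multiplicative
    in [k] ([mulmod_oddM]) and nontrivial for each odd prime
    ([mulmod_odd_nonresidue]). By the former, the sign of [t] is the sign of
    multiplication by [m] modulo the product [N] of the cycle lengths.

    If [N] is a square this sign is always trivial, so [s] is rational. If it is
    not, some prime [p] divides [N] to an odd power, and an [m] congruent to a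
    primitive root mod [p] and to 1 modulo the part of [N] prime to [p] has
    nontrivial sign ([mulmod_odd_nonsquare]): then [s ^+ m] lies in the other
    half of the symmetric class of [s]. That same [m] shows that the two halves
    together form one rational class. The case [m = 1] shows that the
    centralizer of [s] consists of even permutations, so that there are indeed
    two halves; conjugation by an odd permutation exchanges them and preserves rationality. *)

Set Implicit Arguments.
Unset Strict Implicit.
Unset Printing Implicit Defensive.

(** * Computing signs fibre by fibre *)

(** Extending a permutation by the identity along an injection turns a
    decomposition into transpositions into another one of the same length. *)
Lemma odd_perm_ext (U T : finType) (f : U -> T) (s : {perm U}) (t : {perm T}) :
  injective f -> (forall u, t (f u) = f (s u)) ->
  (forall x, x \notin codom f -> t x = x) ->
  odd_perm t = odd_perm s.
Proof.
move=> finj tf tid; have [ts s_ts dts] := prod_tpermP s.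
pose us := [seq (f p.1, f p.2) | p <- ts].
have dus : all dpair us.
  rewrite all_map; apply: sub_all dts => p /=.
  by apply: contraNneq => /finj->.
suff -> : t = (\prod_(p <- us) tperm p.1 p.2)%g.
  by rewrite s_ts !odd_perm_prod // size_map.
have us_im rs u : (\prod_(p <- [seq (f p.1, f p.2) | p <- rs]) tperm p.1 p.2)%g (f u)
    = f ((\prod_(p <- rs) tperm p.1 p.2)%g u).
  elim: rs u => [|p rs IH] u; first by rewrite !big_nil !perm1.
  by rewrite /= !big_cons !permM /= -inj_tperm // IH.
have us_out rs x : x \notin codom f ->
    (\prod_(p <- [seq (f p.1, f p.2) | p <- rs]) tperm p.1 p.2)%g x = x.
  move=> xf; elim: rs => [|p rs IH]; first by rewrite !big_nil !perm1.
  rewrite /= !big_cons !permM /= tpermD ?IH //;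
    by apply: contraNneq xf => <-; apply: codom_f.
apply/permP=> x; have [/codomP[u ->]|xf] := boolP (x \in codom f).
  by rewrite tf us_im -s_ts.
by rewrite tid // us_out.
Qed.

(** A permutation preserving the fibres of [p] is the product of its
    restrictions to them. *)
Lemma odd_perm_fibers (T I : finType) (P : pred I) (p : T -> I) (t : {perm T}) :
  (forall x, P (p x)) -> (forall x, p (t x) = p x) ->
  odd_perm t
    = \big[addb/false]_(i | P i) odd_perm (restr_perm [set x | p x == i] t).
Proof.
move=> Pp pt.
have tN i : t \in 'N([set x | p x == i] | 'P)%g.
  by apply/astabsP=> x; rewrite !inE /= /aperm pt.
have prodE (r : seq I) x : uniq r ->
    (\prod_(i <- r) restr_perm [set x | p x == i] t)%g x
    = if p x \in r then t x else x.
  elim: r x => [|i r IH] x /=; first by rewrite big_nil perm1.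
  case/andP=> ir ur; rewrite big_cons permM IH // in_cons.
  have [pxi|pxi] /= := eqVneq (p x) i.
    have -> : restr_perm [set x | p x == i] t x = t x by rewrite restr_permE // inE pxi.
    by rewrite pt pxi (negPf ir).
  by rewrite (out_perm (restr_perm_on _ _)) // inE.
have -> : t = (\prod_(i <- [seq i <- index_enum I | P i])
                 restr_perm [set x | p x == i] t)%g.
  apply/permP=> x; rewrite prodE ?mem_filter ?Pp ?mem_index_enum //.
  by rewrite filter_uniq // index_enum_uniq.
rewrite (big_morph _ (@odd_permM T) (@odd_perm1 T)) big_filter.
apply: eq_bigr => i Pi; congr odd_perm; congr (restr_perm _ _).
by apply/permP=> x; rewrite prodE ?mem_filter ?Pp ?mem_index_enum //
  filter_uniq // index_enum_uniq.
Qed.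

(** The parametrization [f] of [A] is how the sign on a fibre is transported to
    the integers modulo the size of that fibre. *)
Lemma odd_restr_perm (U T : finType) (A : {set T}) (f : U -> T)
    (s : {perm U}) (t : {perm T}) :
  injective f -> A =i codom f -> (forall u, t (f u) = f (s u)) ->
  odd_perm (restr_perm A t) = odd_perm s.
Proof.
move=> finj Af tf; apply: (@odd_perm_ext _ _ f) => //.
- move=> u; rewrite restr_permE ?tf ?Af ?codom_f //.
  have subA : t @: A \subset A.
    apply/subsetP=> _ /imsetP[x xA ->]; move: xA; rewrite !Af.
    by case/codomP=> v ->; rewrite tf codom_f.
  apply/astabsP=> x /=; rewrite /aperm.
  have /eqP tA : t @: A == A by rewrite eqEcard subA card_imset //=; apply: perm_inj.
  by rewrite -{1}tA mem_imset //; apply: perm_inj.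
- by move=> x xf; rewrite (out_perm (restr_perm_on _ _)) // Af.
Qed.

(** The sign of multiplication by [m] on the integers mod [k], as a boolean
    that is true when this is an odd permutation; when [m] is prime to the odd
    number [k] it encodes the Jacobi symbol of [m] over [k]. Quantifying over the
    permutations that induce this multiplication gives a total function of [k]
    and [m], with value false when there is none. *)
Definition mulmod_odd (k m : nat) : bool :=
  [exists s : {perm 'I_k}, odd_perm s && [forall x, s x == (m * x) %% k :> nat]].

Lemma mulmod_permP k m : 0 < k -> coprime m k ->
  exists s : {perm 'I_k}, forall x, s x = (m * x) %% k :> nat.
Proof.
move=> k0 cmk; pose F (x : 'I_k) := Ordinal (ltn_pmod (m * x) k0).
have Finj : injective F.
  move=> x y /(congr1 val) /= /eqP exy.
  apply: val_inj => /=; apply/eqP.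
  wlog lexy : x y exy / x <= y.
    by move=> W; case/orP: (leq_total x y) => le;
       [apply: W | rewrite eq_sym W // eq_sym].
  move: exy; rewrite eq_sym eqn_mod_dvd ?leq_mul2l ?lexy ?orbT //.
  rewrite -mulnBr Gauss_dvdr 1?coprime_sym // => dvd.
  rewrite eqn_leq lexy -subn_eq0 /=.
  by case: (posnP (y - x)) => [//|/dvdn_leq le]; have := le _ dvd; have := ltn_ord y; lia.
by exists (perm Finj) => x; rewrite permE.
Qed.

Lemma mulmod_oddE k m (s : {perm 'I_k}) :
  (forall x, s x = (m * x) %% k :> nat) -> mulmod_odd k m = odd_perm s.
Proof.
move=> sE; apply/existsP/idP=> [[s' /andP[os /forallP s'E]]|os].
  suff <- : s' = s by [].
  by apply/permP=> x; apply: val_inj; rewrite /= sE; apply/eqP.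
by exists s; rewrite os; apply/forallP=> x; rewrite sE.
Qed.

(** Shifts have odd order dividing [k], hence are even, and only the slope of an
    affine map contributes to its sign. *)
Lemma odd_perm_affine k m c (s : {perm 'I_k}) : odd k ->
  (forall x, s x = (m * x + c) %% k :> nat) -> odd_perm s = mulmod_odd k m.
Proof.
move=> ok sE; have k0 : 0 < k by apply: odd_gt0.
pose F (x : 'I_k) := Ordinal (ltn_pmod (x + c) k0).
have Finj : injective F.
  move=> x y /(congr1 val) /= /eqP; rewrite eqn_modDr !modn_small // => /eqP.
  exact: val_inj.
pose t := perm Finj.
have tX i x : (t ^+ i)%g x = (x + i * c) %% k :> nat.
  elim: i => [|i IH]; first by rewrite expg0 perm1 addn0 modn_small.
  by rewrite expgSr permM permE /= IH modnDml mulSn -addnA [c + _]addnC.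
have tk : (t ^+ k = 1)%g.
  by apply/permP=> x; apply: val_inj; rewrite /= tX mulnC addnC modnMDl perm1 modn_small.
have ot : odd_perm t = false.
  have odX i : odd_perm (t ^+ i)%g = odd i && odd_perm t.
    elim: i => [|i IH]; first by rewrite expg0 odd_perm1.
    by rewrite expgSr odd_permM IH /=; case: (odd i); case: odd_perm.
  by have := odX k; rewrite tk odd_perm1 ok.
rewrite (@mulmod_oddE k m (s * t^-1)%g) ?odd_permM ?odd_permV ?ot ?addbF // => x.
have := sE x; rewrite -{1}(mulgKV t s) permM permE /= => /eqP.
by rewrite eqn_modDr => /eqP <-; rewrite modn_small.
Qed.

Lemma mulmod_odd_mod k m : mulmod_odd k (m %% k) = mulmod_odd k m.
Proof. by apply: eq_existsb => s; congr andb; apply: eq_forallb => x; rewrite modnMml. Qed.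

Lemma mulmod_odd1 k : mulmod_odd k 1 = false.
Proof.
by rewrite (@mulmod_oddE _ _ 1%g) ?odd_perm1 // => x; rewrite perm1 mul1n modn_small.
Qed.

Lemma big_addb_const (I : finType) (b : bool) :
  \big[addb/false]_(i : I) b = odd #|I| && b.
Proof.
rewrite big_const; elim: #|I| => //= n ->.
by case: b; case: (odd n).
Qed.

(** Write the integers mod [a * b] as pairs [i + a * j] with [i < a] and [j < b].
    Multiplication by [m] factors as [r], which multiplies the digit [i] by [m]
    mod [a], followed by a map that fixes [i] and is affine of slope [m] in [j],
    the carry being its constant term. The first factor has [b] fibres, all of
    sign that of [m] mod [a], and the second [a] fibres, all of sign that of [m]
    mod [b]; as [a] and [b] are odd these repetitions do not change the sign. *)
Lemma mulmod_oddM a b m : odd a -> odd b -> coprime m (a * b) ->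
  mulmod_odd (a * b) m = mulmod_odd a m (+) mulmod_odd b m.
Proof.
move=> oa ob cm; have a0 := odd_gt0 oa; have b0 := odd_gt0 ob.
have ab0 : 0 < a * b by rewrite muln_gt0 a0.
move: (cm); rewrite coprimeMr => /andP[cma cmb].
have [u uE] := mulmod_permP a0 cma.
have [v vE] := mulmod_permP ab0 cm.
have ltF i j : i < a -> j < b -> i + a * j < a * b by nia.
pose F (i : 'I_a) (j : 'I_b) : 'I_(a * b) := Ordinal (ltF i j (ltn_ord i) (ltn_ord j)).
pose p1 (x : 'I_(a * b)) := Ordinal (ltn_pmod x a0).
have p2_subproof (x : 'I_(a * b)) : x %/ a < b by rewrite ltn_divLR // [X in _ < X]mulnC.
pose p2 (x : 'I_(a * b)) := Ordinal (p2_subproof x).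
have p1F i j : p1 (F i j) = i.
  by apply: val_inj; rewrite /= mulnC addnC modnMDl modn_small.
have p2F i j : p2 (F i j) = j.
  by apply: val_inj; rewrite /= mulnC addnC divnMDl // divn_small // addn0.
have FK x : F (p1 x) (p2 x) = x.
  by apply: val_inj; rewrite /= addnC [a * _]mulnC -divn_eq.
have F1inj i : injective (F i) by move=> j j' /(congr1 p2); rewrite !p2F.
have F2inj j : injective (F^~ j) by move=> i i' /(congr1 p1); rewrite !p1F.
have rinj : injective (fun x => F (u (p1 x)) (p2 x)).
  move=> x y e; rewrite -(FK x) -(FK y).
  move: (congr1 p1 e) (congr1 p2 e).
  by rewrite !p1F !p2F => /perm_inj -> ->.
pose r := perm rinj.
have orE : odd_perm r = mulmod_odd a m.
  rewrite (@odd_perm_fibers _ _ predT p2) //; last by move=> x; rewrite permE p2F.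
  rewrite (eq_bigr (fun=> mulmod_odd a m)) => [|j _].
    by rewrite big_addb_const card_ord ob.
  rewrite (mulmod_oddE uE).
  apply: (@odd_restr_perm _ _ _ (F^~ j)) => // [x|i].
    rewrite inE; apply/eqP/codomP=> [<-|[i ->]]; last by rewrite p2F.
    by exists (p1 x); rewrite FK.
  by rewrite permE p1F p2F.
have w1 x : p1 ((r^-1 * v)%g x) = p1 x.
  rewrite -(permKV r x); move: ((r^-1)%g x) => y.
  rewrite permM permK [in RHS]permE p1F.
  by apply: val_inj; rewrite /= vE uE modnMmr modn_dvdm // dvdn_mulr.
suff owE : odd_perm (r^-1 * v)%g = mulmod_odd b m.
  by rewrite (mulmod_oddE vE) -(mulKVg r v) odd_permM orE owE.
rewrite (@odd_perm_fibers _ _ predT p1) //.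
rewrite (eq_bigr (fun=> mulmod_odd b m)) => [|i _].
  by rewrite big_addb_const card_ord oa.
(* The digit [i] is that of [m * i0], and [c] is the carry. *)
pose i0 := (u^-1 i)%g; pose c := (m * i0) %/ a.
have wF j : (r^-1 * v)%g (F i j) = ((m * i0) %% a + a * ((m * j + c) %% b))%N :> nat.
  have -> : F i j = r (F i0 j) by rewrite permE p1F p2F permKV.
  rewrite permM permK vE /= muln_modr.
  have -> : m * (i0 + a * j) = (m * i0) %% a + a * (m * j + c).
    by rewrite {1}(mulnDr m) {1}(divn_eq (m * i0) a) -/c; nia.
  rewrite -modnDmr modn_small // -muln_modr.
  by rewrite ltF ?ltn_pmod.
pose S j := p2 ((r^-1 * v)%g (F i j)).
have FS j : (r^-1 * v)%g (F i j) = F i (S j) by rewrite -{1}(FK (_ (F i j))) w1 p1F.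
have Sinj : injective S.
  by move=> j j' e; apply/(F1inj i)/(@perm_inj _ (r^-1 * v)%g); rewrite !FS e.
rewrite (@odd_restr_perm _ _ _ (F i) (perm Sinj)) // => [|x|j].
- apply: (odd_perm_affine (c := c)) => // j; rewrite permE /= wF.
  by rewrite [a * _]mulnC addnC divnMDl // divn_small ?addn0 ?ltn_pmod.
- rewrite inE; apply/eqP/codomP=> [<-|[j ->]]; last by rewrite p1F.
  by exists (p2 x); rewrite FK.
by rewrite FS permE.
Qed.

(** * Squares and the sign of multiplication *)

Lemma primitive_root_modP p : prime p ->
  exists2 g, coprime g p &
    forall x, coprime x p -> exists i, x = g ^ i %[mod p].
Proof.
move=> pr; have p1 := prime_gt1 pr.
pose F : finFieldType := 'F_p.
have /hasP[z _ zP] : has (p.-1).-primitive_root%R (enum [pred x : F | x != 0%R]).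
  apply: has_prim_root => //; first by lia.
  - apply/allP=> x; rewrite mem_enum inE => x0; rewrite unity_rootE.
    have := expf_card x.
    rewrite card_Fp // -{1}(prednK (prime_gt0 pr)) GRing.exprS => e.
    by rewrite -(inj_eq (GRing.mulfI x0)) e GRing.mulr1.
  - exact: enum_uniq.
  - by rewrite -cardE cardC1 card_Fp.
have eqE (a b : nat) : (a == b %[mod p]) = (inZp a == inZp b :> 'F_p).
  by rewrite -val_eqE /= Fp_cast.
have inZpX a i : inZp (a ^ i) = ((inZp a : 'F_p) ^+ i)%R.
  by rewrite -!(Zp_nat) GRing.natrX.
have zz : inZp z = z :> 'F_p by rewrite valZpK.
have cop0 x : coprime x p = (inZp x != 0%R :> 'F_p).
  by rewrite coprime_sym prime_coprime // -val_eqE /= Fp_cast.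
exists (z : nat).
  rewrite cop0 zz; apply/eqP=> z0.
  have := prim_expr_order zP; rewrite z0 GRing.expr0n.
  have -> : (p.-1 == 0)%N = false by lia.
  by move/eqP; rewrite eq_sym GRing.oner_eq0.
move=> x; rewrite cop0 => x0.
have /(prim_rootP zP)[i xE] : ((inZp x : 'F_p) ^+ p.-1 = 1)%R.
  apply: (GRing.mulfI x0); rewrite -GRing.exprS GRing.mulr1 prednK ?prime_gt0 //.
  by have := expf_card (inZp x : 'F_p); rewrite card_Fp.
by exists i; apply/eqP; rewrite eqE inZpX zz xE.
Qed.

(** Multiplication by a primitive root has just two orbits, zero and the
    nonzero residues, so it is odd on a set of odd size. *)
Lemma mulmod_odd_nonresidue p : prime p -> odd p ->
  exists2 g, coprime g p & mulmod_odd p g.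
Proof.
move=> pr op; have [g cg gen] := primitive_root_modP pr; exists g => //.
have p0 := prime_gt0 pr; have p1 := prime_gt1 pr.
have [s sE] := mulmod_permP p0 cg; rewrite (mulmod_oddE sE).
have sX i x : (s ^+ i)%g x = (g ^ i * x) %% p :> nat.
  elim: i => [|i IH]; first by rewrite expg0 perm1 mul1n modn_small.
  by rewrite expgSr permM sE IH modnMmr expnS mulnA.
pose o0 : 'I_p := Ordinal p0; pose o1 : 'I_p := Ordinal p1.
suff E : porbits s = [set porbit s o0; porbit s o1].
  rewrite /odd_perm card_ord op E cards2 eq_porbit_mem.
  suff -> : o0 \in porbit s o1 = false by [].
  apply/negP=> /porbitP[i /(congr1 val)] /=; rewrite sX muln1 => /esym/eqP.
  have := coprimeXl i cg; rewrite coprime_sym prime_coprime // => /negPf.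
  by rewrite /dvdn => ->.
apply/setP=> X; rewrite !inE; apply/imsetP/idP=> [[x _ ->]|].
  have [x0|x0] := eqVneq x o0; first by rewrite x0 eqxx.
  rewrite [X in _ || X]eq_porbit_mem orbC.
  have /gen[i xE] : coprime x p.
    rewrite coprime_sym prime_coprime // gtnNdvd //.
    by rewrite lt0n; apply: contraNneq x0 => x0; apply/eqP/val_inj.
  suff -> : x = (s ^+ i)%g o1 by rewrite mem_porbit.
  by apply: val_inj; rewrite /= sX muln1 -xE modn_small.
by case/orP=> /eqP->; [exists o0 | exists o1].
Qed.

Lemma square_or_odd_logn N : 0 < N ->
  (exists2 p, prime p & odd (logn p N)) \/ exists k, N = k ^ 2.
Proof.
move=> N0; have [/hasP[p]|/hasPn ev] := boolP (has (fun p => odd (logn p N)) (primes N)).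
  by rewrite mem_primes => /and3P[pr _ _] op; left; exists p.
right; exists (\prod_(p <- primes N) p ^ (logn p N)./2).
rewrite {1}(prod_prime_decomp N0) prime_decompE big_map /=.
rewrite -mulnn -big_split /=; apply: eq_big_seq => p /ev /negPf ol.
by rewrite -expnD addnn -[in LHS](odd_double_half (logn p N)) ol.
Qed.

Lemma mulmod_oddX p v m : odd p -> coprime m p ->
  mulmod_odd (p ^ v) m = odd v && mulmod_odd p m.
Proof.
move=> op cm; elim: v => [|v IH].
  by rewrite expn0 -mulmod_odd_mod modn1 -(modn1 1) mulmod_odd_mod mulmod_odd1.
rewrite expnS mulmod_oddM ?oddX ?op ?orbT // ?coprimeMr ?cm ?coprimeXr //.
by rewrite IH /=; case: (odd v); case: mulmod_odd.
Qed.

Lemma mulmod_odd_square k m : odd k -> coprime m k -> mulmod_odd (k ^ 2) m = false.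
Proof. by move=> ok cm; rewrite mulmod_oddX. Qed.

(** The Chinese remainder theorem gives an [m] that is a primitive root mod [p]
    and 1 modulo the part of [N] prime to [p]; its sign mod [N] is that of an odd
    power of the nontrivial sign mod [p]. *)
Lemma mulmod_odd_nonsquare N p : 0 < N -> odd N -> prime p -> odd (logn p N) ->
  exists2 m, coprime m N & mulmod_odd N m.
Proof.
move=> N0 oN pr ol.
have [v0|v0] := posnP (logn p N); first by rewrite v0 in ol.
have pN : p %| N by move: v0; rewrite logn_gt0 mem_primes => /and3P[].
have op : odd p by apply: dvdn_odd pN oN.
have [u cpu NE] := pfactor_coprime pr N0.
have [g cg zg] := mulmod_odd_nonresidue pr op.
have ou : odd u by move: oN; rewrite NE oddM => /andP[].
pose m := chinese p u g 1.
have mp : m = g %[mod p] by apply: chinese_modl.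
have mu : m = 1 %[mod u] by apply: chinese_modr.
have cmp : coprime m p by rewrite -coprime_modl mp coprime_modl.
have cmu : coprime m u by rewrite -coprime_modl mu coprime_modl coprime1n.
exists m; rewrite NE.
  by rewrite coprimeMr cmu coprimeXr.
rewrite mulmod_oddM ?coprimeMr ?cmu ?coprimeXr // ?oddX ?op ?orbT //.
rewrite mulmod_oddX // ol -mulmod_odd_mod mu mulmod_odd_mod mulmod_odd1.
by rewrite -mulmod_odd_mod mp mulmod_odd_mod.
Qed.

Lemma mulmod_odd_prod (I : eqType) (r : seq I) (P : pred I) (F : I -> nat) m :
    (forall i, P i -> odd (F i)) -> (forall i, P i -> coprime m (F i)) ->
  mulmod_odd (\prod_(i <- r | P i) F i) m
    = \big[addb/false]_(i <- r | P i) mulmod_odd (F i) m.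
Proof.
move=> oF cF; elim: r => [|i r IH].
  by rewrite !big_nil -mulmod_odd_mod modn1 -(modn1 1) mulmod_odd_mod mulmod_odd1.
rewrite !big_cons; case: ifP => // Pi; rewrite -IH mulmod_oddM ?oF //.
  by elim/big_ind: _ => // a b oa ob; rewrite oddM oa.
rewrite coprimeMr cF //=.
by elim/big_ind: _ => // [|a b ca cb]; rewrite ?coprimen1 // coprimeMr ca.
Qed.

(** * Orbits of a permutation and of its conjugates *)

Section Orbits.
Variable T : finType.
Implicit Types (s t : {perm T}) (x y : T).

Lemma card_porbit_gt0 s x : 0 < #|porbit s x|.
Proof. by rewrite lt0n card_porbit_neq0. Qed.

Lemma permX_modn s x u : (s ^+ (u %% #|porbit s x|))%g x = (s ^+ u)%g x.
Proof.
have sd : (s ^+ #|porbit s x|)%g x = x by rewrite permX iter_porbit.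
rewrite {2}(divn_eq u #|porbit s x|) expgD mulnC expgM permM; congr (_ _).
elim: (u %/ _) => [|k IH]; first by rewrite expg0 perm1.
by rewrite expgS permM sd.
Qed.

(** Orbits behave as cyclic groups: this is what identifies the orbit of [x] with
    the integers modulo its size. *)
Lemma permX_eq s x u v :
  ((s ^+ u)%g x == (s ^+ v)%g x) = (u == v %[mod #|porbit s x|]).
Proof.
rewrite -(permX_modn _ _ u) -(permX_modn _ _ v).
have d0 := card_porbit_gt0 s x; set d := #|_| in d0 *.
have E k : k < d -> (s ^+ k)%g x = nth x (traject s x d) k.
  by move=> kd; rewrite nth_traject ?permX.
by rewrite !E ?ltn_pmod // nth_uniq ?size_traject ?ltn_pmod // uniq_traject_porbit.
Qed.

Definition orbit_pt s x (u : 'I_#|porbit s x|) : T := (s ^+ u)%g x.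

Lemma orbit_pt_inj s x : injective (@orbit_pt s x).
Proof.
move=> u v /eqP; rewrite permX_eq !modn_small // => /eqP; exact: val_inj.
Qed.

Lemma codom_orbit_pt s x : porbit s x =i codom (@orbit_pt s x).
Proof.
move=> y; apply/porbitP/codomP => [[i ->]|[u ->]]; last by exists u.
by exists (Ordinal (ltn_pmod i (card_porbit_gt0 s x))); rewrite /orbit_pt permX_modn.
Qed.

Lemma dvdn_card_porbit_order s x : #|porbit s x| %| #[s]%g.
Proof.
rewrite /dvdn -(mod0n #|porbit s x|) -permX_eq.
by rewrite expg_order expg0.
Qed.

Lemma porbit_expg_coprime s m : coprime m #[s]%g -> porbit (s ^+ m)%g =1 porbit s.
Proof.
rewrite coprime_sym -generator_coprime => /eqP gs x.
by rewrite porbit.unlock gs.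
Qed.

Lemma porbits_expg_coprime s m : coprime m #[s]%g -> porbits (s ^+ m)%g = porbits s.
Proof. by move=> /porbit_expg_coprime cm; rewrite /porbits (eq_imset _ cm). Qed.

Lemma porbitJ s t x : porbit (s ^ t)%g (t x) = t @: porbit s x.
Proof.
apply/setP=> y; apply/porbitP/imsetP => [[i ->]|[z /porbitP[i ->] ->]].
  by exists ((s ^+ i)%g x); rewrite ?mem_porbit // -conjXg permJ.
by exists i; rewrite -conjXg permJ.
Qed.

Lemma porbitsJ s t : porbits (s ^ t)%g = [set t @: (X : {set T}) | X in porbits s].
Proof.
apply/setP=> X; apply/imsetP/imsetP => [[x _ ->]|[_ /imsetP[x _ ->] ->]].
  exists (porbit s (t^-1 x)%g); first exact: imset_f.
  by rewrite -porbitJ permKV.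
by exists (t x); rewrite ?porbitJ.
Qed.

Lemma mem_porbits s X x : X \in porbits s -> x \in X -> X = porbit s x.
Proof. by case/imsetP=> y _ -> /porbitP[i ->]; rewrite porbit_perm. Qed.

(** Since [t] sends the orbit of [x] under [s] to an orbit of the same size,
    it preserves it when sizes are distinct. If [t x = (s ^+ c) x], then [t] maps
    [(s ^+ u) x] to [(s ^+ (m * u + c)) x], an affine map of slope [m]. *)
Lemma odd_conj_expg s t m : coprime m #[s]%g ->
    {in porbits s, forall X : {set T}, odd #|X|} ->
    {in porbits s &, injective (fun X : {set T} => #|X|)} ->
    (s ^ t = s ^+ m)%g ->
  odd_perm t = \big[addb/false]_(X in porbits s) mulmod_odd #|X| m.
Proof.
move=> cm oX injX st.
have tN x : porbit s (t x) = porbit s x.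
  apply: injX; try exact: imset_f.
  by rewrite -(porbit_expg_coprime cm) -st porbitJ card_imset //; apply: perm_inj.
rewrite (@odd_perm_fibers _ _ [in porbits s] (porbit s)) //; last first.
  by move=> x; apply: imset_f.
apply: eq_bigr => _ /imsetP[x _ ->].
have [c tx] : exists c, t x = (s ^+ c)%g x by apply/porbitP; rewrite -eq_porbit_mem tN.
have tX u : t ((s ^+ u)%g x) = (s ^+ (m * u + c))%g x.
  by rewrite -permJ conjXg st tx -expgM -permM -expgD addnC.
pose d := #|porbit s x|; have d0 : 0 < d := card_porbit_gt0 s x.
pose F (u : 'I_d) := Ordinal (ltn_pmod (m * u + c) d0).
have tF u : t (orbit_pt u) = orbit_pt (F u) by rewrite /orbit_pt tX permX_modn.
have Finj : injective F.
  by move=> u v e; apply/orbit_pt_inj/(@perm_inj _ t); rewrite !tF e.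
rewrite (@odd_restr_perm _ _ _ (@orbit_pt s x) (perm Finj)) //.
- apply: (odd_perm_affine (c := c)); first by apply: oX; apply: imset_f.
  by move=> u; rewrite permE.
- by exact: orbit_pt_inj.
- by move=> y; rewrite inE eq_porbit_mem codom_orbit_pt.
by move=> u; rewrite permE tF.
Qed.

Lemma order_dvdn_porbits s N :
  {in porbits s, forall X : {set T}, #|X| %| N} -> #[s]%g %| N.
Proof.
move=> dX; rewrite order_dvdn; apply/eqP/permP=> x; rewrite perm1 -[RHS](perm1 x) -(expg0 s).
by apply/eqP; rewrite permX_eq mod0n; apply: dX; apply: imset_f.
Qed.

(** The cycle of [s] through [x] commutes with [s], and it is odd because on
    the orbit of [x] it is the cyclic shift of an even number of points. *)
Lemma odd_centralizer_even_porbit s x : ~~ odd #|porbit s x| ->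
  exists2 t, odd_perm t & (s ^ t)%g = s.
Proof.
move=> ed; exists (restr_perm (porbit s x) s); last first.
  by apply/conjg_fixP/commgP/commute_sym; apply: restr_perm_commute.
pose d := #|porbit s x|; have d0 : 0 < d := card_porbit_gt0 s x.
pose F (u : 'I_d) := Ordinal (ltn_pmod u.+1 d0).
have sF u : s (orbit_pt u) = orbit_pt (F u).
  by rewrite /orbit_pt permX_modn expgSr permM.
have Finj : injective F.
  by move=> u v e; apply/orbit_pt_inj/(@perm_inj _ s); rewrite !sF e.
rewrite (@odd_restr_perm _ _ _ (@orbit_pt s x) (perm Finj)) //.
- have FX i : (perm Finj ^+ i)%g (Ordinal d0) = i %% d :> nat.
    elim: i => [|i IH]; first by rewrite expg0 perm1 mod0n.
    by rewrite expgSr permM permE /= IH -addn1 modnDml addn1.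
  rewrite /odd_perm card_ord (negPf ed).
  suff -> : porbits (perm Finj) = [set porbit (perm Finj) (Ordinal d0)].
    by rewrite cards1.
  apply/setP=> X; rewrite inE; apply/imsetP/eqP => [[u _ ->]|->]; last by exists (Ordinal d0).
  apply/eqP; rewrite eq_porbit_mem; apply/porbitP; exists u.
  by apply: val_inj; rewrite /= FX modn_small.
- exact: orbit_pt_inj.
- exact: codom_orbit_pt.
by move=> u; rewrite permE sF.
Qed.

(** Exchanging [(s ^+ i) x] with [(s ^+ i) y] for all [i] commutes with [s] and
    is a product of as many transpositions as the orbits have points. *)
Lemma odd_centralizer_equal_porbits s x y : porbit s x != porbit s y ->
    #|porbit s x| = #|porbit s y| -> odd #|porbit s x| ->
  exists2 t, odd_perm t & (s ^ t)%g = s.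
Proof.
move=> nXY eXY od; set d := #|porbit s x| in eXY od.
have d0 : 0 < d := card_porbit_gt0 s x.
pose a i := tperm ((s ^+ i)%g x) ((s ^+ i)%g y).
have nxy i j : (s ^+ i)%g x != (s ^+ j)%g y.
  apply: contraNneq nXY => e.
  by rewrite -(porbit_perm s i x) e porbit_perm.
have aJ i : (a i ^ s)%g = a i.+1 by rewrite /a tpermJ expgSr !permM.
have aE i j : i = j %[mod d] -> a i = a j.
  move=> /eqP e; congr tperm; apply/eqP; first by rewrite permX_eq.
  by rewrite permX_eq -eXY.
have aC i j : commute (a i) (a j).
  have [/eqP/aE -> //|ne] := boolP (i == j %[mod d]).
  apply/commgP/conjg_fixP; rewrite /a tpermJ.
  have yx i' j' : (s ^+ i')%g y != (s ^+ j')%g x by rewrite eq_sym nxy.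
  by rewrite !tpermD ?nxy ?yx // permX_eq // -?eXY eq_sym.
exists (\prod_(0 <= i < d) a i)%g.
  rewrite (big_morph _ (@odd_permM T) (@odd_perm1 T)).
  rewrite (eq_bigr (fun=> true)) => [|i _]; last by rewrite odd_tperm nxy.
  rewrite big_const_nat subn0.
  by elim: d od {d0 eXY aE aC} => //= k IH ok; case: (odd k) IH ok => [->|] //=; case: iter.
apply/conjg_fixP/commgP/commute_sym/commgP/conjg_fixP.
rewrite (big_morph (conjg^~ s) (fun u v => conjMg u v s) (conj1g s)).
rewrite (eq_bigr (fun i => a i.+1)) => [|i _]; last exact: aJ.
case: d d0 od eXY aE aC => // k _ _ _ aE aC.
(* Conjugation by [s] shifts the indices cyclically, which moves the factor
   [a 0] from one end of the product to the other. *)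
rewrite big_nat_recr //= (aE k.+1 0) ?modnn ?mod0n // big_nat_recl //=.
symmetry; apply: (big_ind (commute (a 0))) => // [|u v cu cv].
  exact: commute1.
exact: commuteM.
Qed.

(** In each fibre of [f] the map [phi] matches the enumerations of the elements
    of [A] and [B] rank by rank. *)
Lemma bij_of_card_fibers (U : finType) (A B : {set U}) (f : U -> nat) :
    (forall d, #|[set c in A | f c == d]| = #|[set c in B | f c == d]|) ->
  exists phi : U -> U,
    [/\ {in A, forall X, phi X \in B}, {in A, forall X, f (phi X) = f X}
      & {in A &, injective phi}].
Proof.
move=> eAB; pose L (C : {set U}) d := enum [set c in C | f c == d].
pose phi X := nth X (L B (f X)) (index X (L A (f X))).
have idx X : X \in A -> index X (L A (f X)) < size (L B (f X)).
  by move=> XA; rewrite -cardE -eAB cardE index_mem mem_enum inE XA eqxx.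
have phiL X : X \in A -> phi X \in L B (f X) by move=> XA; apply: mem_nth; apply: idx.
have phiB X : X \in A -> phi X \in B by move/phiL; rewrite mem_enum inE => /andP[].
have phif X : X \in A -> f (phi X) = f X.
  by move/phiL; rewrite mem_enum inE => /andP[_ /eqP].
exists phi; split=> // X Y XA YA e.
have ef : f X = f Y by rewrite -phif // e phif.
move: e; rewrite /phi -ef (set_nth_default X Y) ?ef ?idx // -ef.
move/eqP; rewrite nth_uniq ?enum_uniq ?idx // ?[in X in _ < X]ef ?ef ?idx // => /eqP.
by rewrite -ef; apply: (index_inj X); rewrite mem_enum inE ?XA ?YA ?ef eqxx.
Qed.

(** Match the orbits of [s] with those of [s'] of the same size, choose a base
    point [b X] in each orbit [X], and send [(s ^+ j) (b X)] to
    [(s' ^+ j) (b (phi X))]; this does not depend on [j] because the two orbits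
    have the same size. *)
Lemma conj_of_card_porbits s s' :
    (forall d, #|[set c in porbits s | #|c| == d]|
               = #|[set c in porbits s' | #|c| == d]|) ->
  exists t, s' = (s ^ t)%g.
Proof.
move=> /bij_of_card_fibers[phi [phiP phic phi_inj]].
have [x0 _|T0] := pickP T; last first.
  by exists 1%g; apply/permP=> x; have := T0 x.
pose b (X : {set T}) := odflt x0 [pick y in X].
have bP (u : {perm T}) X : X \in porbits u -> porbit u (b X) = X.
  move=> Xu; apply/esym/(mem_porbits Xu); rewrite /b.
  case/imsetP: Xu => y _ ->; case: pickP => [z zX|X0]; first exact: zX.
  by have := X0 y; rewrite porbit_id.
have sO x : porbit s x \in porbits s by apply: imset_f.
pose X x := porbit s x.
have bX x : porbit s (b (X x)) = X x by apply: bP.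
have bY x : porbit s' (b (phi (X x))) = phi (X x) by apply: bP; apply: phiP.
pose j x := index x (traject s (b (X x)) #|X x|).
have jP x : x = (s ^+ (j x))%g (b (X x)).
  have xin : x \in traject s (b (X x)) #|X x|.
    by rewrite -{2}bX -porbit_traject bX porbit_id.
  have jlt : j x < #|X x| by rewrite -[in X in _ < X](size_traject s (b (X x)) #|X x|) index_mem.
  by rewrite permX -(nth_traject s jlt) nth_index.
pose t x := (s' ^+ (j x))%g (b (phi (X x))).
have Xt x : porbit s' (t x) = phi (X x) by rewrite porbit_perm bY.
have tinj : injective t.
  move=> x y e; have eX : X x = X y by apply: phi_inj; rewrite ?sO // -!Xt e.
  move: e; rewrite /t -eX => /eqP; rewrite permX_eq bY phic // => /eqP e.
  rewrite (jP x) (jP y) -eX; apply/eqP; rewrite permX_eq bX; exact/eqP.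
exists (perm tinj); apply/permP=> z; rewrite -(permKV (perm tinj) z).
move: ((perm tinj)^-1 z)%g => x; rewrite permJ !permE.
have eX : X (s x) = X x by rewrite /X (porbit_perm s 1).
rewrite /t eX -permM -expgSr; apply/eqP.
rewrite permX_eq bY phic // -(bX x) -permX_eq -{2}eX -jP expgSr permM -jP.
exact: eqxx.
Qed.
End Orbits.

(** * Rational elements of a finite group *)

Section Rational.
Variable gT : finGroupType.
Implicit Types (G : {group gT}) (g x : gT).

(** Integer exponents prime to the order may be replaced by natural ones, the
    only exponents considered in the sequel: [-1] is congruent to the order of
    [g] minus 1. *)
Lemma expgz_nat g m : coprimez m (Posz #[g]%g) ->
  exists2 k, coprime k #[g]%g & expgz g m = (g ^+ k)%g.
Proof.
rewrite coprimezE; case: m => k /= cop; first by exists k.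
exists (k.+1 * #[g]%g.-1).
  by rewrite coprimeMl cop coprime_sym coprimenP.
by rewrite mulnC expgM -invg_expg expgVn.
Qed.

Lemma expgzJ g x m : expgz (g ^ x)%g m = (expgz g m ^ x)%g.
Proof. by case: m => k /=; rewrite ?conjVg conjXg. Qed.

(** Conjugation by the normalizer rather than by [G] alone, so as to cover the
    odd permutations, which exchange the two halves of a split class. *)
Lemma rational_eltJ G g x : x \in 'N(G)%g -> rational_elt G g ->
  rational_elt G (g ^ x)%g.
Proof.
move=> xN [gG rg]; split; first by rewrite memJ_norm.
move=> m; rewrite orderJ expgzJ => /rg /imsetP[y yG ->]; apply/imsetP.
by exists (y ^ x)%g; rewrite ?memJ_norm // -!conjgM conjgC.
Qed.

Lemma rational_conj_classE G g : rational_conj_class G (g ^: G)%g <-> rational_elt G g.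
Proof.
split=> [[h rh gh]|rg]; last by exists g.
have /imsetP[x xG ->] : g \in (h ^: G)%g by rewrite -gh class_refl.
by apply: rational_eltJ => //; apply: subsetP xG; apply: normG.
Qed.

Lemma rational_conj_class_is_rational_class G (K : {set gT}) :
  rational_conj_class G K -> is_rational_class G K.
Proof.
case=> g [gG rg] ->; exists g => // x; split=> [xK|[m /rg mK]].
  by exists (Posz 1); rewrite /= ?expg1 // coprimezE coprime1n.
by rewrite (class_eqP mK).
Qed.

End Rational.

(** * Rationality in the alternating group *)

Section Alternating.
Variable T : finType.
Implicit Types (s t x : {perm T}).

Definition distinct_odd_porbits s :=
  {in porbits s, forall X : {set T}, odd #|X|} /\
  {in porbits s &, injective (fun X : {set T} => #|X|)}.

Lemma conj_expg_coprime s m : coprime m #[s]%g -> exists t, (s ^ t = s ^+ m)%g.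
Proof.
move=> cm; have [|t ->] := @conj_of_card_porbits T s (s ^+ m)%g; last by exists t.
by rewrite porbits_expg_coprime.
Qed.

Lemma Alt_norms t : t \in 'N('Alt_T)%g.
Proof. by apply: (subsetP (Alt_norm T)); rewrite inE. Qed.

Lemma odd_conj_expg_prod s t m : distinct_odd_porbits s -> coprime m #[s]%g ->
  (s ^ t = s ^+ m)%g -> odd_perm t = mulmod_odd (\prod_(X in porbits s) #|X|) m.
Proof.
move=> [oX iX] cm st; rewrite mulmod_odd_prod ?(odd_conj_expg cm oX iX st) // => X.
case/imsetP=> x _ ->; apply: coprime_dvdr cm.
exact: dvdn_card_porbit_order.
Qed.

Lemma even_centralizer s t : distinct_odd_porbits s -> (s ^ t)%g = s -> ~~ odd_perm t.
Proof.
by move=> ds st; rewrite (@odd_conj_expg_prod s t 1) ?mulmod_odd1 ?coprime1n ?expg1.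
Qed.

(** The two halves of a symmetric class with distinct odd cycle lengths are
    different, because no odd permutation centralizes an element of the class. *)
Lemma not_Alt_class s t : distinct_odd_porbits s -> odd_perm t ->
  (s ^ t)%g \notin (s ^: 'Alt_T)%g.
Proof.
move=> ds ot; apply/negP=> /imsetP[u]; rewrite Alt_even => eu st.
have /(even_centralizer ds) : (s ^ (t * u^-1))%g = s by rewrite conjgM st conjgK.
by rewrite odd_permM odd_permV ot (negPf eu).
Qed.

Lemma Alt_class_odd_centralizer s t x : odd_perm t -> (s ^ t)%g = s ->
  (s ^ x)%g \in (s ^: 'Alt_T)%g.
Proof.
move=> ot st; have [ox|ex] := boolP (odd_perm x); last first.
  by apply: imset_f; rewrite Alt_even.
by rewrite -{1}st -conjgM; apply: imset_f; rewrite Alt_even odd_permM ot ox.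
Qed.

Lemma rational_odd_centralizer s t : s \in ('Alt_T)%G -> odd_perm t ->
  (s ^ t)%g = s -> rational_elt ('Alt_T)%G s.
Proof.
move=> sA ot st; split=> // m /expgz_nat[k ck ->].
by have [u <-] := conj_expg_coprime ck; apply: Alt_class_odd_centralizer ot st.
Qed.

Lemma rational_square s : s \in ('Alt_T)%G -> distinct_odd_porbits s ->
  (exists k, \prod_(X in porbits s) #|X| = k ^ 2) -> rational_elt ('Alt_T)%G s.
Proof.
move=> sA ds [k Nk]; split=> // m /expgz_nat[j cj ->].
have [u su] := conj_expg_coprime cj; rewrite -su; apply: imset_f.
have Nj : coprime j (k ^ 2).
  rewrite -Nk coprime_sym; elim/big_ind: _ => [|a b ca cb|_ /imsetP[x _ ->]].
  - exact: coprime1n.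
  - by rewrite coprimeMl ca.
  by rewrite coprime_sym; apply: coprime_dvdr cj; apply: dvdn_card_porbit_order.
have oN : odd (k ^ 2).
  rewrite -Nk; elim/big_ind: _ => // [a b oa ob|X]; first by rewrite oddM oa.
  by case: ds => oX _; apply: oX.
rewrite Alt_even (odd_conj_expg_prod ds cj su) Nk.
by rewrite mulmod_odd_square //; [move: oN; rewrite oddX | move: Nj; rewrite coprime_pexpr].
Qed.

Lemma nonsquare_odd_conj s p : distinct_odd_porbits s ->
  prime p -> odd (logn p (\prod_(X in porbits s) #|X|)) ->
  exists m, exists2 t, coprime m #[s]%g & odd_perm t /\ (s ^ t = s ^+ m)%g.
Proof.
move=> ds pr ol; have [oX _] := ds; set N := (X in logn p X) in ol.
have oN : odd N.
  by rewrite /N; elim/big_ind: _ => // a b oa ob; rewrite oddM oa.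
have [m cm zm] := mulmod_odd_nonsquare (odd_gt0 oN) oN pr ol.
have cms : coprime m #[s]%g.
  apply: coprime_dvdr cm; apply: order_dvdn_porbits => X Xs.
  by rewrite /N (bigD1 X) //= dvdn_mulr.
have [t st] := conj_expg_coprime cms; exists m, t => //.
by rewrite (odd_conj_expg_prod ds cms st).
Qed.

Lemma nonrational_odd_conj s m t : distinct_odd_porbits s -> coprime m #[s]%g ->
  odd_perm t -> (s ^ t = s ^+ m)%g -> ~ rational_elt ('Alt_T)%G s.
Proof.
move=> ds cm ot st [_ /(_ (Posz m))]; rewrite /= -st.
by move/(_ cm) => h; have := not_Alt_class ds ot; rewrite h.
Qed.

(** The symmetric class of [s] consists of the alternating classes of [s] and of
    [s ^ t], and the latter is that of the power [s ^+ m]. *)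
Lemma Sym_class_is_rational_class s m t : s \in ('Alt_T)%G -> coprime m #[s]%g ->
  odd_perm t -> (s ^ t = s ^+ m)%g ->
  is_rational_class ('Alt_T)%G (s ^: 'Sym_T)%g.
Proof.
move=> sA cm ot st; exists s => // x; split.
  case/imsetP=> u _ ->; have [ou|eu] := boolP (odd_perm u).
    exists (Posz m) => //=; rewrite -st; apply/imsetP.
    exists (t^-1 * u)%g; first by rewrite Alt_even odd_permM odd_permV ot ou.
    by rewrite -conjgM mulKVg.
  exists (Posz 1); rewrite /= ?coprimezE ?coprime1n ?expg1 //.
  by apply: imset_f; rewrite Alt_even.
case=> k /expgz_nat[j cj ->]; have [u <-] := conj_expg_coprime cj.
by case/imsetP=> v _ ->; rewrite -conjgM; apply: imset_f; rewrite inE.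
Qed.

End Alternating.

(** * Cycle types *)

Section CycleType.
Variables (n r : nat) (lam e : 'I_r -> nat).
Hypothesis hlam : is_partition n lam e.
Implicit Types s t : {perm 'I_n}.

Lemma partition_inj : injective lam.
Proof.
case: hlam => _ mono _ _ i j eij; apply: val_inj => /=.
by case: (ltngtP i j) => // /mono; rewrite eij ltnn.
Qed.

Lemma card_porbits_part s i : has_cycle_type s lam e ->
  #|[set c in porbits s | #|c| == lam i]| = e i.
Proof.
move=> ->; rewrite (big_pred1 i) // => j.
by rewrite inj_eq //; apply: partition_inj.
Qed.

Lemma odd_centralizer_cycle_type s : has_cycle_type s lam e ->
  (exists i, 2 <= e i) \/ (exists i, ~~ odd (lam i)) ->
  exists2 t, odd_perm t & (s ^ t)%g = s.
Proof.
move=> sP; have ev i : ~~ odd (lam i) -> exists2 t, odd_perm t & (s ^ t)%g = s.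
  move=> el; case: hlam => _ _ /(_ i) + _; rewrite -(card_porbits_part i sP).
  case/card_gt0P=> X; rewrite inE => /andP[/imsetP[x _ ->] /eqP eX].
  by apply: (@odd_centralizer_even_porbit _ _ x); rewrite eX.
case=> -[i]; last exact: ev.
have [ol|/ev//] := boolP (odd (lam i)).
rewrite -(card_porbits_part i sP) => /card_gt1P[X [Y []]].
rewrite !inE => /andP[/imsetP[x _ ->] /eqP eX] /andP[/imsetP[y _ ->] /eqP eY] XY.
by apply: (odd_centralizer_equal_porbits XY); rewrite eX ?eY.
Qed.

Lemma has_cycle_typeJ s t : has_cycle_type s lam e -> has_cycle_type (s ^ t)%g lam e.
Proof.
move=> sP d; rewrite -sP; rewrite porbitsJ.
rewrite -(card_imset [in [set c in porbits s | _]] (imset_inj (@perm_inj _ t))).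
apply: eq_card => X; rewrite !inE; apply/andP/imsetP.
  by case=> /imsetP[Y Ys ->]; rewrite card_imset; [exists Y; rewrite ?inE ?Ys | exact: perm_inj].
case=> Y; rewrite inE => /andP[Ys Yd] ->.
by rewrite imset_f // card_imset //; apply: perm_inj.
Qed.

Lemma conj_of_cycle_type s s' : has_cycle_type s lam e ->
  has_cycle_type s' lam e -> exists t, s' = (s ^ t)%g.
Proof. by move=> sP sP'; apply: conj_of_card_porbits => d; rewrite sP sP'. Qed.

(** When no part is repeated, orbit sizes and parts agree as multisets, which
    transfers products from orbits to parts. *)
Lemma card_porbits_perm_eq s : has_cycle_type s lam e -> (forall i, e i = 1) ->
  perm_eq [seq #|X| | X : {set 'I_n} in porbits s] [seq lam i | i <- enum 'I_r].
Proof.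
move=> sP e1; apply/allP=> d _ /=; rewrite !count_map -!sum1_count !big_enum_cond /=.
rewrite -(eq_bigr _ (fun i _ => e1 i)) -sP -sum1_card.
by apply/eqP/eq_bigl => X; rewrite inE.
Qed.

Lemma distinct_odd_cycle_type s : has_cycle_type s lam e ->
  (forall i, e i = 1) -> (forall i, odd (lam i)) ->
  distinct_odd_porbits s /\ \prod_(X in porbits s) #|X| = \prod_i lam i.
Proof.
move=> sP e1 ol; have pe := card_porbits_perm_eq sP e1; split.
  split=> [X Xs|X Y Xs Ys /= eXY].
    have : #|X| \in [seq #|X| | X : {set 'I_n} in porbits s].
      by apply: map_f; rewrite mem_enum.
    by rewrite (perm_mem pe) => /mapP[i _ ->].
  have [i eX] : exists i, #|X| = lam i.
    have : #|X| \in [seq #|X| | X : {set 'I_n} in porbits s].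
      by apply: map_f; rewrite mem_enum.
    by rewrite (perm_mem pe) => /mapP[i _ ->]; exists i.
  have /eqP/cards1P[Z eZ] := etrans (card_porbits_part i sP) (e1 i).
  have : X \in [set Z] by rewrite -eZ inE Xs eX /=.
  have : Y \in [set Z] by rewrite -eZ inE Ys -eXY eX /=.
  by rewrite !inE => /eqP-> /eqP->.
have := perm_big _ pe (op := muln) (x := 1) (P := predT) (F := id).
by rewrite !big_map !big_enum.
Qed.

End CycleType.

(** * Classes of the alternating group *)

Theorem theorem1p5 (n : nat) (hn : 4 <= n)
    (Ct : {set {perm 'I_n}}) (hCt : Ct \in classes 'Alt_('I_n)%G)
    (r : nat) (lam e : 'I_r -> nat) (hlam : is_partition n lam e)
    (hCtlam : class_has_cycle_type Ct lam e) :
  (* (1) *)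
  ((rational_conj_class 'Alt_('I_n)%G Ct <->
      (((exists i, 2 <= e i) \/ (exists i, ~~ odd (lam i))) \/
       [/\ forall i, e i = 1,
           forall i, odd (lam i)
         & exists k : nat, \prod_(i < r) lam i = k ^ 2]))
   /\
   ((forall i, e i = 1) -> (forall i, odd (lam i)) ->
      exists K1 K2 : {set {perm 'I_n}},
        [/\ K1 <> K2,
            forall K : {set {perm 'I_n}},
              (K \in classes 'Alt_('I_n)%G /\ class_has_cycle_type K lam e)
              <-> (K = K1 \/ K = K2)
          & (rational_conj_class 'Alt_('I_n)%G K1 /\
             rational_conj_class 'Alt_('I_n)%G K2) \/
            (~ rational_conj_class 'Alt_('I_n)%G K1 /\
             ~ rational_conj_class 'Alt_('I_n)%G K2)]))
  /\
  (* (2) *)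
  ((forall K : {set {perm 'I_n}}, K \in classes 'Alt_('I_n)%G ->
      rational_conj_class 'Alt_('I_n)%G K -> is_rational_class 'Alt_('I_n)%G K)
   /\
   (~ rational_conj_class 'Alt_('I_n)%G Ct ->
      forall C : {set {perm 'I_n}},
        C \in classes 'Sym_('I_n)%G -> Ct \subset C ->
        is_rational_class 'Alt_('I_n)%G C)).
Proof.
case/imsetP: hCt => s sA CtE; set A := ('Alt_('I_n))%G.
have sC : s \in Ct by rewrite CtE class_refl.
have sP := hCtlam s sC.
have dec : ((exists i, 2 <= e i) \/ (exists i, ~~ odd (lam i))) \/
           (forall i, e i = 1) /\ (forall i, odd (lam i)).
  have [/existsP[i ei]|/existsPn e1] := boolP [exists i, 2 <= e i].
    by left; left; exists i.
  have [/existsP[i ei]|/existsPn ol] := boolP [exists i, ~~ odd (lam i)].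
    by left; right; exists i.
  right; split=> i; last by have := ol i; rewrite negbK.
  by case: hlam => _ _ /(_ i) e0 _; apply/eqP; rewrite eqn_leq e0 leqNgt e1.
have dis : (forall i, e i = 1) -> (forall i, odd (lam i)) ->
    [/\ distinct_odd_porbits s, \prod_(X in porbits s) #|X| = \prod_i lam i
      & (exists k : nat, \prod_(i < r) lam i = k ^ 2) /\ rational_elt A s \/
        exists m, exists2 t, coprime m #[s]%g & odd_perm t /\ (s ^ t = s ^+ m)%g].
  move=> e1 ol; have [ds Ns] := distinct_odd_cycle_type hlam sP e1 ol.
  split=> //; have N0 : 0 < \prod_i lam i by rewrite prodn_cond_gt0 // => i _; apply: odd_gt0.
  have [[p pr op]|sq] := square_or_odd_logn N0.
    by right; apply: (nonsquare_odd_conj ds pr); rewrite Ns.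
  by left; split=> //; apply: rational_square => //; rewrite Ns.
have cases : rational_elt A s <->
     (((exists i, 2 <= e i) \/ (exists i, ~~ odd (lam i))) \/
       [/\ forall i, e i = 1, forall i, odd (lam i)
         & exists k : nat, \prod_(i < r) lam i = k ^ 2]).
  split=> [rs|[a|[e1 ol sq]]].
  - case: dec => [a|[e1 ol]]; [by left | right; split=> //].
    case: (dis e1 ol) => ds _ [[]//|[m [t cm [ot st]]]].
    by case: (nonrational_odd_conj ds cm ot st).
  - have [t ot st] := odd_centralizer_cycle_type hlam sP a.
    exact: rational_odd_centralizer ot st.
  case: (dis e1 ol) => ds Ns _.
  by apply: rational_square => //; rewrite Ns.
split; [split | split].
- by rewrite CtE rational_conj_classE.
- move=> e1 ol; have [ds _ rat] := dis e1 ol.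
  have n1 : 1 < n by lia.
  pose t := tperm (Ordinal (ltnW n1)) (Ordinal n1).
  have ot : odd_perm t by rewrite odd_tperm.
  have tP : forall u, (s ^ u)%g \in A by move=> u; rewrite memJ_norm ?Alt_norms.
  exists Ct, ((s ^ t) ^: A)%g; split.
  + move=> e12; have := not_Alt_class ds ot.
    by rewrite -CtE e12 class_refl.
  + move=> K; split.
      case=> /imsetP[k kA ->] /(_ k (class_refl _ _)) kP.
      have [u ->] := conj_of_cycle_type sP kP.
      have [ou|eu] := boolP (odd_perm u); last first.
        by left; rewrite CtE; apply/class_eqP/imset_f; rewrite Alt_even.
      right; apply/class_eqP/imsetP; exists (t^-1 * u)%g.
        by rewrite Alt_even odd_permM odd_permV ot ou.
      by rewrite -conjgM mulKVg.
    case=> ->; first by rewrite CtE in hCtlam *; split=> //; apply: imset_f.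
    split; first by apply: imset_f.
    by move=> _ /imsetP[v _ ->]; do 2 apply: has_cycle_typeJ.
  rewrite CtE !rational_conj_classE; case: rat => [[_ rs]|[m [u cm [ou su]]]].
    by left; split=> //; apply: rational_eltJ => //; apply: Alt_norms.
  have nr := nonrational_odd_conj ds cm ou su; right; split=> // rst.
  by apply: nr; rewrite -(conjgK t s); apply: rational_eltJ rst; apply: Alt_norms.
- by move=> K _; apply: rational_conj_class_is_rational_class.
rewrite CtE rational_conj_classE => nr C /imsetP[c _ ->] /subsetP/(_ s).
rewrite class_refl => /(_ isT)/class_eqP <-.
case: dec => [a|[e1 ol]]; first by case: nr; apply/cases; left.
case: (dis e1 ol) => ds _ [[_ /nr]//|[m [t cm [ot st]]]].
exact: (Sym_class_is_rational_class sA cm ot st).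
Qed.
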